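(* Let $\mathbf{z}\mapsto v(\mathbf{z})$ be an auxiliary controller such that the closed-loop auxiliary system $$\frac{\mathrm{d}\mathbf{z}}{\mathrm{d}\tau}=\mathbf{J}\mathbf{z}+\mathbf{b}_n(v(\mathbf{z})+\pi(\tau))$$ is asymptotically stable with settling-time function $\mathcal{T}(\mathbf{z}_0)$ satisfying $\sup_{\mathbf{z}_0\in\mathbb{R}^n}\mathcal{T}(\mathbf{z}_0)\le T_f$, where $T_f\in\mathbb{R}_+\cup\{\infty\}$. Consider the chain of integrators $\dot x_i=x_{i+1}$ ($i=1,\ldots,n-1$), $\dot x_n=u(\mathbf{x},t;T_c)+d(t)$, $|d(t)|\le\Delta$, under the hybrid controller $u(\mathbf{x},t;T_c)=\phi(\mathbf{x},t;T_c)$ for $t\in[0,T_c)$ and $u(\mathbf{x},t;T_c)=w(\mathbf{x};\Delta)$ otherwise, where $$\phi(\mathbf{x},t;T_c)=\beta\kappa(t)^{n-\rho}\left[v\big(\beta^{-1}\mathbf{Q}_\rho\mathbf{K}_\rho^{-1}(t)\mathbf{x}\big)-\beta^{-1}\mathbf{b}_1^T(\mathbf{J}-\alpha\mathbf{D}_\rho)^n\mathbf{K}_\rho^{-1}(t)\mathbf{x}\right],$$ and let $$T(\mathbf{x}_0)=\eta^{-1}T_c\left(1-\exp\left(-\alpha\,\mathcal{T}(\beta^{-1}\mathbf{Q}_\rho\mathbf{K}_\rho^{-1}(0)\mathbf{x}_0)\right)\right)$$ be the settling-time function of this closed-loop system. Then, under this hybrid controller: 1. If $\mathcal{T}(\mathbf{z}_0)=\infty$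 (for all $\mathbf{z}_0\neq0$), then the settling-time function satisfies $T(\mathbf{x}_0)=T_c$ (for all $\mathbf{x}_0\neq 0$). Thus the controller is a prescribed-time controller, but $\lim_{t\to T(\mathbf{x}_0)^-}\kappa(t)=\infty$. 2. If $\mathcal{T}(\mathbf{z}_0)<\infty$ (for all $\mathbf{z}_0$), but $T_f=\infty$, then the time-varying gain $\kappa(T(\mathbf{x}_0))$ is finite but an unbounded function of the initial condition $\mathbf{x}_0$, i.e. $\sup_{\mathbf{x}_0\in\mathbb{R}^n}\kappa(T(\mathbf{x}_0))=\infty$. Thus the controller is a predefined-time controller with a finite (but unbounded) time-varying gain at the settling time. 3. If $\sup_{\mathbf{z}_0\in\mathbb{R}^n}\mathcal{T}(\mathbf{z}_0)\le T_f$ with a known $T_f<\infty$, then the settling-time function satisfies $T(\mathbf{x}_0)\le T_c$, and $\kappa(t)$ is bounded by $\kappa_{\max}:=\dfrac{\exp(\alpha T_f)-1}{\alpha T_c}$ for $t\in[0,T_c)$. Thus the controller is a predefined-time controller with bounded time-varying gain.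
   Context: Parameters: $n$ is the order of the chain of integrators, $\mathbf{x}=[x_1,\ldots,x_n]^T$, $\alpha\ge0$, $\rho\in[0,n]$, $T_f\in\mathbb{R}_+\cup\{\infty\}$ with $\mathbb{R}_+=[0,\infty)$, $T_c>0$ is the desired convergence time, $\Delta\ge0$ is a known constant, and $$\kappa(t)=\frac{\eta}{\alpha(T_c-\eta t)},\qquad \eta=1-\exp(-\alpha T_f),\qquad \beta\ge(\alpha\eta^{-1}T_c)^{n-\rho},$$ with $\exp(-\infty)=0$. Expressions at $\alpha=0$ (with $T_f<\infty$) are understood as limits $\alpha\to0$, e.g. $\kappa(t)=T_f/T_c$. Matrices: $\mathbf{J}=[a_{ij}]\in\mathbb{R}^{n\times n}$ has $a_{ij}=1$ if $j=i+1$ and $a_{ij}=0$ otherwise; $\mathbf{b}_i\in\mathbb{R}^n$ has $1$ in entry $i$ and zeros elsewhere; $\mathbf{D}_\rho:=\mathrm{diag}\{-\rho,1-\rho,\ldots,n-1-\rho\}$; $\mathbf{Q}_\rho\in\mathbb{R}^{n\times n}$ has $k$-th row $\mathbf{b}_1^T(\mathbf{J}-\alpha\mathbf{D}_\rho)^{k-1}$, $k=1,\ldots,n$; $\mathbf{K}_\rho(t):=\mathrm{diag}(\kappa(t)^{-\rho},\kappa(t)^{1-\rho},\ldots,\kappa(t)^{n-1-\rho})$. Settling-time function of a system with set $\Pi$ of admissible disturbances, where $\mathbf{x}(t;\mathbf{x}_0,d)$ is the solution (in the sense of Filippov) with initial condition $\mathbf{x}_0$ and disturbance $d$: $T(\mathbf{x}_0):=\inf\{\xi\ge0:\forall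 d\in\Pi,\ \lim_{t\to\xi}\mathbf{x}(t;\mathbf{x}_0,d)=0\}\in\mathbb{R}_+\cup\{\infty\}$. For the auxiliary system (time variable $\tau$), the disturbances are those $\pi$ with $|\pi(\tau)|\le\Delta\exp(-\alpha(n-\rho)\tau)$, and the settling-time function is denoted $\mathcal{T}$. Asymptotic stability refers to the origin. A controller is a predefined-time controller if the settling-time function of the closed-loop system satisfies $\sup_{\mathbf{x}_0\in\mathbb{R}^n}T(\mathbf{x}_0)\le T_c<\infty$, and a prescribed-time controller if $T(\mathbf{x}_0)=T_c<\infty$ for all $\mathbf{x}_0\ne0$. The controller $w(\mathbf{x};\Delta)$ is a robust controller which maintains the chain of integrators at the origin in spite of any disturbance with $|d(t)|\le\Delta$.
   Formalization: In item 2, ''T_f = ∞'' is strengthened to: the supremum of 𝒯(z_0) over all z_0 equals T_f = ∞; with T_f = ∞ merely an upper bound, a bounded 𝒯 would make κ(T(x_0)) bounded and the claim false. *)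

(* Defs.v *)
From HB Require Import structures.
From mathcomp Require Import all_boot all_order all_algebra.
From mathcomp Require Import all_classical all_reals all_analysis.

Set Implicit Arguments.
Unset Strict Implicit.
Unset Printing Implicit Defensive.

Import Order.TTheory GRing.Theory Num.Theory.
Import numFieldNormedType.Exports.

Local Open Scope classical_set_scope.
Local Open Scope ring_scope.

Section Filippov.
Context {R : realType} {n : nat}.
Implicit Types (A N : set 'cV[R]_n) (x : R -> 'cV[R]_n).

(* Lebesgue-null subsets of R^n: coverable by countably many boxes of
   arbitrarily small total volume. *)
Definition lebesgue_null N := forall e : R, 0 < e ->
  exists a b : nat -> 'cV[R]_n,
    (forall k i, a k i 0 <= b k i 0) /\
    N `<=` \bigcup_k [set y | forall i, a k i 0 <= y i 0 <= b k i 0] /\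
    (\sum_(0 <= k <oo) (\prod_(i < n) (b k i 0 - a k i 0))%:E <= e%:E)%E.

Definition closed_convex_hull A : set 'cV[R]_n :=
  \bigcap_(C in [set C : set 'cV[R]_n | [/\ closed C, convex_set C & A `<=` C]]) C.

Definition filippov (g : 'cV[R]_n -> 'cV[R]_n) (y : 'cV[R]_n) : set 'cV[R]_n :=
  \bigcap_(delta in [set delta : R | 0 < delta])
    \bigcap_(N in lebesgue_null) closed_convex_hull (g @` (ball y delta `\` N)).

Definition abs_continuous (a b : R) x := forall e : R, 0 < e ->
  exists2 delta : R, 0 < delta & forall (m : nat) (l r : 'I_m -> R),
    (forall i, a <= l i /\ l i <= r i /\ r i <= b) ->
    (forall i j : 'I_m, (i < j)%N -> r i <= l j) ->
    \sum_(i < m) (r i - l i) < delta ->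
    \sum_(i < m) `|x (r i) - x (l i)| < e.

(* x solves dx/dt = f(t, x), x(0) = x0 on [0, +oo[ in the sense of Filippov;
   values of x at negative times are irrelevant. *)
Definition filippov_solution (f : R -> 'cV[R]_n -> 'cV[R]_n)
    (x0 : 'cV[R]_n) x :=
  [/\ x 0 = x0,
      forall b, 0 < b -> abs_continuous 0 b x &
      {ae (@lebesgue_measure R), forall t, 0 < t ->
         derivable x t 1 /\ filippov (f t) (x t) (derive1 x t)}].

End Filippov.

Section DisturbedSystems.
Context {R : realType} {n : nat}.

(* [f d t x] is the right-hand side at time t and state x under the
   disturbance d; [Pi] is the set of admissible disturbances. *)
Implicit Types (f : (R -> R) -> R -> 'cV[R]_n -> 'cV[R]_n) (Pi : set (R -> R)).

(* Borel and Lebesgue measurability give the same Filippov solutions, since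
   a disturbance only matters up to a null set of times. *)
Definition disturbances (bound : R -> R) : set (R -> R) :=
  [set d : R -> R | measurable_fun (`[0, +oo[ : set R) d /\ forall t, 0 <= t -> `|d t| <= bound t].

(* Filippov solutions need not be unique, so x(t; x0, d) ranges over all of
   them; requiring at least one keeps the condition from holding vacuously. *)
Definition settling_time f Pi (x0 : 'cV[R]_n) : \bar R :=
  ereal_inf [set xi%:E | xi in [set xi : R | 0 <= xi /\
    forall d, Pi d ->
      (exists x, filippov_solution (f d) x0 x) /\
      forall x, filippov_solution (f d) x0 x ->
        x t @[t --> within (`[0, +oo[ : set R) (nbhs xi)] --> (0 : 'cV[R]_n)]].

Definition lyapunov_stable f Pi := forall e : R, 0 < e ->
  exists2 delta : R, 0 < delta & forall x0 : 'cV[R]_n, `|x0| < delta ->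
    forall d x, Pi d -> filippov_solution (f d) x0 x ->
    forall t, 0 <= t -> `|x t| < e.

Definition attractive f Pi := exists2 r : R, 0 < r &
  forall x0 : 'cV[R]_n, `|x0| < r ->
    forall d x, Pi d -> filippov_solution (f d) x0 x ->
    x t @[t --> +oo] --> (0 : 'cV[R]_n).

Definition asymptotically_stable f Pi := lyapunov_stable f Pi /\ attractive f Pi.

End DisturbedSystems.

Section Chain.
Context {R : realType}.
Variable n : nat.

Definition shiftmx : 'M[R]_n := \matrix_(i, j) (j == i.+1 :> nat)%:R.

(* One-based: [bvec i] is the vector b_i, for 1 <= i <= n. *)
Definition bvec (i : nat) : 'cV[R]_n := \col_j (j.+1 == i)%:R.

Definition integrator_chain (u : 'cV[R]_n -> R -> R)
    (d : R -> R) (t : R) (x : 'cV[R]_n) : 'cV[R]_n :=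
  shiftmx *m x + (u x t + d t) *: bvec n.

Definition chain_settling_time (u : 'cV[R]_n -> R -> R) (Delta : R) :
    'cV[R]_n -> \bar R :=
  settling_time (integrator_chain u) (disturbances (fun=> Delta)).

Definition predefined_time_controller u Delta (Tc : R) :=
  (ereal_sup (range (chain_settling_time u Delta)) <= Tc%:E)%E.

Definition prescribed_time_controller u Delta (Tc : R) :=
  forall x0, x0 != 0 -> chain_settling_time u Delta x0 = Tc%:E.

Definition maintains_origin (w : 'cV[R]_n -> R -> R) (Delta : R) :=
  forall d, disturbances (fun=> Delta) d ->
    let sys := integrator_chain (fun x _ => w x Delta) d in
    filippov_solution sys 0 (fun=> 0) /\
    forall x, filippov_solution sys 0 x -> forall t, 0 <= t -> x t = 0.

End Chain.

Section Redesign.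
Context {R : realType}.
Variable n : nat.
Variables (alpha rho Tc : R) (Tf : \bar R).

(* An expression F(alpha), read as its limit for alpha -> 0+ at alpha = 0. *)
Definition at_alpha {T : ptopologicalType} (F : R -> T) : T :=
  if alpha == 0 then lim (F a @[a --> 0^'+]) else F alpha.

(* exp(- a s) with exp(-oo) = 0 *)
Definition expN (a : R) (s : \bar R) : R := fine (expeR (- (a%:E * s))%E).

Definition eta (a : R) : R := 1 - expN a Tf.

(* Extended-real valued: +oo at the pole t = Tc / eta. *)
Definition kappa (t : R) : \bar R :=
  at_alpha (fun a => (eta a)%:E / (a * (Tc - eta a * t))%:E)%E.

Definition kappa_max : R :=
  at_alpha (fun a => (expR (a * fine Tf) - 1) / (a * Tc)).

Definition beta_min : R :=
  at_alpha (fun a => (a * (eta a)^-1 * Tc) `^ (n%:R - rho)).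

Definition Dmx : 'M[R]_n := diag_mx (\row_i (i%:R - rho)).

Definition JDmx : 'M[R]_n := shiftmx n - alpha *: Dmx.

(* Row k, counted from 0, is b_1^T (J - alpha D)^k. *)
Definition Qmx : 'M[R]_n := \matrix_(k < n) ((bvec n 1)^T *m JDmx ^+ k).

Definition Kmx (t : R) : 'M[R]_n :=
  diag_mx (\row_i fine (kappa t) `^ (i%:R - rho)).

Definition phi (beta : R) (v : 'cV[R]_n -> R) (x : 'cV[R]_n) (t : R) : R :=
  beta * fine (kappa t) `^ (n%:R - rho) *
  (v (beta^-1 *: (Qmx *m invmx (Kmx t) *m x))
   - beta^-1 * ((bvec n 1)^T *m JDmx ^+ n *m invmx (Kmx t) *m x) 0 0).

Definition hybrid_controller (beta Delta : R) (v : 'cV[R]_n -> R)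
    (w : 'cV[R]_n -> R -> R) (x : 'cV[R]_n) (t : R) : R :=
  if 0 <= t < Tc then phi beta v x t else w x Delta.

Definition aux_settling_time (Delta : R) (v : 'cV[R]_n -> R) :
    'cV[R]_n -> \bar R :=
  settling_time (integrator_chain (fun z _ => v z))
    (disturbances (fun tau => Delta * expR (- alpha * (n%:R - rho) * tau))).

Definition aux_asymptotically_stable (Delta : R) (v : 'cV[R]_n -> R) :=
  asymptotically_stable (integrator_chain (fun z _ => v z))
    (disturbances (fun tau => Delta * expR (- alpha * (n%:R - rho) * tau))).

(* The value eta^-1 Tc (1 - exp(- alpha s)) of the closed-loop settling time
   when the auxiliary one is s. *)
Definition redesigned_time (s : \bar R) : R :=
  at_alpha (fun a => (eta a)^-1 * Tc * (1 - expN a s)).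

End Redesign.

(* Main.v *)
Require Import Defs.
From HB Require Import structures.
From mathcomp Require Import all_boot all_order all_algebra.
From mathcomp Require Import all_classical all_reals all_analysis.
From mathcomp Require Import ring lra.
Import Order.TTheory GRing.Theory Num.Theory.
Import numFieldNormedType.Exports.
Local Open Scope classical_set_scope.
Local Open Scope ring_scope.

(** The time change t = eta^-1 Tc (1 - exp(- alpha tau)) sends the auxiliary
    time tau in [0, Tf] increasingly onto [0, Tc], and kappa is, up to the
    constant eta / (alpha Tc), the gain exp(alpha tau) seen in the new time.
    The three claims are readings of the resulting formula
    T x0 = eta^-1 Tc (1 - exp(- alpha s)), where s = calT z0 and
    z0 = beta^-1 Q K(0)^-1 x0.

    As 0 <= s <= Tf, monotonicity gives T x0 <= Tc at once
    ([redesigned_time_le]), which is the predefined-time property.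

    If Tf is infinite, then alpha > 0 and eta = 1, so
    kappa t = 1 / (alpha (Tc - t)). An infinite s gives T x0 = Tc, the pole of
    kappa ([kappa_cvg_pinfty]); a finite s gives the gain
    exp(alpha s) / (alpha Tc) at the settling time ([kappa_redesigned_time]),
    finite but unbounded if s is. Both conclusions are about all x0 whereas the
    hypotheses are about all z0, so x0 |-> z0 must be bijective: beta > 0
    ([beta_min_pinfty_gt0]), K(0) is diagonal with positive entries
    ([Kmx_unit]), and Q is unitriangular ([Qmx_unit]).

    If Tf is finite, kappa increases on [0, Tc) towards
    eta / (alpha Tc (1 - eta)) = kappa_max ([kappa_le_max]).

    For alpha = 0 the expressions are limits, which all reduce to the slope at
    the origin of a |-> exp(a c) ([cvg_expR_slope]): kappa and kappa_max both
    become Tf / Tc and the settling time becomes (Tc / Tf) s. *)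

(** * Limits in alpha and the exponential *)

Lemma at_alpha_neq0 (R : realType) (alpha : R) (T : ptopologicalType)
    (F : R -> T) : alpha != 0 -> at_alpha alpha F = F alpha.
Proof. by rewrite /at_alpha => /negbTE ->. Qed.

Lemma at_alpha0 (R : realType) (T : ptopologicalType) (F : R -> T) (l : T) :
  hausdorff_space T -> F a @[a --> 0^'+] --> l -> at_alpha 0 F = l.
Proof. by rewrite /at_alpha eqxx => hT /cvg_lim; apply. Qed.

Section Exponential.
Context {R : realType}.
Implicit Types (a c F : R) (s Tf : \bar R).

Lemma expN_pinfty a : 0 < a -> expN a +oo = 0.
Proof. by move=> a0; rewrite /expN gt0_muley ?lte_fin. Qed.

Lemma expN_ge0 a s : 0 <= expN a s.
Proof. by rewrite /expN fine_ge0 // expeR_ge0. Qed.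

Lemma le_expN a s Tf : 0 < a -> (0 <= s)%E -> (s <= Tf)%E ->
  expN a Tf <= expN a s <= 1.
Proof.
move=> a0; case: s => [s| |] //; case: Tf => [F| |] //.
- rewrite !lee_fin => s0 sF; rewrite /expN /= ler_expR lerN2 ler_pM2l// sF /=.
  by rewrite -[leRHS]expR0 ler_expR oppr_le0 mulr_ge0// ltW.
- rewrite lee_fin => s0 _; rewrite expN_pinfty // expN_ge0 /=.
  by rewrite -[leRHS]expR0 ler_expR oppr_le0 mulr_ge0// ltW.
- by move=> _ _; rewrite expN_pinfty // lexx ler01.
Qed.

Lemma eta_pinfty a : 0 < a -> Defs.eta +oo%E a = 1.
Proof. by move=> a0; rewrite /Defs.eta expN_pinfty// subr0. Qed.

Lemma cvg_expR_slope c : (expR (a * c) - 1) / a @[a --> 0^'+] --> c.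
Proof.
have cexp : expR (a * c) @[a --> 0] --> (1 : R).
  suff : expR (a * c) @[a --> 0] --> expR (0 * c) by rewrite mul0r expR0.
  apply: (cvg_comp _ expR); last exact: continuous_expR.
  by apply: cvgMr_tmp; exact: cvg_id.
apply: (@lhopital_at_right _ _ (fun a => c * expR (a * c)) _ (fun=> 1) 0 1 c)
  => //.
- move=> x _.
  have dlin : is_derive x 1 ( *%R^~ c) c.
    by apply: is_derive_eq; rewrite scaler0 add0r /GRing.scale /= mulr1.
  have dexp : is_derive x 1 (expR \o *%R^~ c) (expR (x * c) * c).
    exact: is_derive1_comp.
  have -> : c * expR (x * c) = expR (x * c) * c - 0 by rewrite subr0 mulrC.
  exact (is_deriveB dexp (is_derive_cst (1 : R) x (1 : R))).
- apply: cvg_at_right_filter; rewrite -[X in _ --> X](subrr 1).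
  by apply: cvgB => //; exact: cvg_cst.
- exact: cvg_at_right_filter.
- apply: cvg_at_right_filter.
  have -> : nbhs c = nbhs (c * 1 / 1) by rewrite mulr1 divr1.
  by apply: cvgM; [apply: cvgM => //; exact: cvg_cst | exact: cvg_cst].
Qed.

(** The first-order behaviour of eta at alpha = 0; applied to the auxiliary
    settling time instead of Tf, it also handles 1 - exp(- alpha s). *)
Lemma cvg_eta_div F : Defs.eta F%:E a / a @[a --> 0^'+] --> F.
Proof.
rewrite -[X in _ --> X]opprK.
rewrite (_ : (fun _ => _) = (fun a => - ((expR (a * - F) - 1) / a)));
  last first.
  by apply/funext => a; rewrite mulrN -[RHS]mulNr opprB.
exact: cvgN (cvg_expR_slope (- F)).
Qed.

End Exponential.

(** * The gain and the settling time at alpha = 0 *)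

Section Limits.
Context {R : realType} (Tc : R) (Tc0 : 0 < Tc).
Implicit Types (F t : R).

Lemma kappa_max_alpha0 F : kappa_max 0 Tc F%:E = F / Tc.
Proof.
apply: at_alpha0; first exact: norm_hausdorff.
rewrite (_ : (fun _ => _) = (fun a => (expR (a * F) - 1) / a / Tc)).
  by apply: cvgMr_tmp; exact: cvg_expR_slope.
by apply/funext => a /=; rewrite invfM mulrA.
Qed.

(** The gain is (eta / a) / (Tc - eta t), whose numerator tends to F and whose
    denominator tends to Tc: at alpha = 0 the gain is constant in time. *)
Lemma kappa_alpha0 F t : kappa 0 Tc F%:E t = (F / Tc)%:E.
Proof.
apply: at_alpha0; first exact: ereal_hausdorff.
have eta0 : Defs.eta F%:E a @[a --> 0^'+] --> 0.
  suff : Defs.eta F%:E a @[a --> 0^'+] --> F * 0 by rewrite mulr0.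
  have : Defs.eta F%:E a / a * a @[a --> 0^'+] --> F * 0.
    by apply: cvgM; [exact: cvg_eta_div | exact: cvg_at_right_filter].
  apply: cvg_trans; apply: near_eq_cvg; near=> a.
  by rewrite divfK // gt_eqF.
have den : Tc - Defs.eta F%:E a * t @[a --> 0^'+] --> Tc.
  rewrite -[X in _ --> X]subr0 -[X in _ --> _ - X](mul0r t).
  apply: cvgB; first exact: cvg_cst.
  exact: cvgMr_tmp.
have quo : Defs.eta F%:E a / a / (Tc - Defs.eta F%:E a * t)
    @[a --> 0^'+] --> F / Tc.
  apply: cvgM; first exact: cvg_eta_div.
  by apply: cvgV den; rewrite gt_eqF.
(* Close to 0 the denominator is positive, so the extended quotient is the
   real one. *)
have fin : \forall a \near 0^'+, ((Defs.eta F%:E a)%:E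
    / (a * (Tc - Defs.eta F%:E a * t))%:E)%E
    = (Defs.eta F%:E a / a / (Tc - Defs.eta F%:E a * t))%:E :> \bar R.
  near=> a.
  have a0 : a != 0 by rewrite gt_eqF.
  have den0 : 0 < Tc - Defs.eta F%:E a * t.
    by near: a; apply: (cvgr_gt Tc).
  by rewrite inver mulf_eq0 (negbTE a0) gt_eqF //= -EFinM invfM mulrA.
apply: cvg_EFin.
  by near=> a; rewrite (near fin).
by apply: cvg_trans quo; apply: near_eq_cvg; near=> a => /=; rewrite (near fin).
Unshelve. all: by end_near.
Qed.

(** For alpha -> 0 the two exponential defects are compared to first order.
    For F = 0 both sides vanish, because 0 is its own inverse. *)
Lemma redesigned_time_alpha0 F s :
  redesigned_time 0 Tc F%:E s%:E = F^-1 * Tc * s.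
Proof.
apply: at_alpha0; first exact: norm_hausdorff.
have [->|F0] := eqVneq F 0.
  rewrite (_ : (fun _ => _) = cst 0); last first.
    apply/funext => a; rewrite /Defs.eta /expN /= mulr0 oppr0 expR0 subrr.
    by rewrite invr0 !mul0r.
  by rewrite invr0 !mul0r; exact: cvg_cst.
have : (Defs.eta F%:E a / a)^-1 * Tc * (Defs.eta s%:E a / a)
   @[a --> 0^'+] --> F^-1 * Tc * s.
  apply: cvgM; last exact: cvg_eta_div.
  by apply: cvgMr_tmp; apply: cvgV => //; exact: cvg_eta_div.
apply: cvg_trans; apply: near_eq_cvg; near=> a.
have a0 : a != 0 by rewrite gt_eqF.
by rewrite -/(Defs.eta _ _) invf_div; move: (_^-1) => y; field.
Unshelve. all: by end_near.
Qed.

End Limits.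

(** * The gain and the settling time for general alpha *)

Section Gain.
Context {R : realType} (alpha Tc : R) (Tc0 : 0 < Tc).
Implicit Types (t : R) (s Tf : \bar R).

(** The defect 1 - exp(- alpha s) increases with s and equals eta at s = Tf. *)
Lemma redesigned_time_le Tf s : 0 <= alpha -> (alpha = 0 -> (Tf < +oo)%E) ->
  (0 <= s)%E -> (s <= Tf)%E -> redesigned_time alpha Tc Tf s <= Tc.
Proof.
rewrite le_eqVlt => /predU1P[<- /(_ erefl)|a0 _].
  case: Tf s => [F| |] [s| |] //= _; rewrite !lee_fin => s0 sF.
  rewrite redesigned_time_alpha0 mulrAC.
  rewrite ler_piMl ?(ltW Tc0)//.
  have [->|F0] := eqVneq F 0; first by rewrite invr0 mul0r ler01.
  by rewrite ler_pdivrMl ?mulr1// lt_def F0 (le_trans s0).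
move=> s0 sF; rewrite /redesigned_time at_alpha_neq0 ?gt_eqF//.
have /andP[h1 h2] := le_expN _ _ _ a0 s0 sF.
rewrite mulrAC ler_piMl ?(ltW Tc0)// /Defs.eta.
(* eta vanishes exactly when Tf = 0. *)
have [e1|e1] := eqVneq (1 - expN alpha Tf) 0.
  by rewrite e1 invr0 mul0r ler01.
rewrite ler_pdivrMl ?mulr1 ?lerB//.
by rewrite lt_def e1 subr_ge0 (le_trans h1).
Qed.

Hypothesis a0 : 0 < alpha.

Lemma kappaE Tf t : 0 < Tc - Defs.eta Tf alpha * t ->
  kappa alpha Tc Tf t =
    (Defs.eta Tf alpha / (alpha * (Tc - Defs.eta Tf alpha * t)))%:E.
Proof.
move=> den; rewrite /kappa at_alpha_neq0 ?gt_eqF//.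
by rewrite inver gt_eqF ?mulr_gt0//= -EFinM.
Qed.

Lemma kappa_pinfty t : t < Tc ->
  kappa alpha Tc +oo t = ((alpha * (Tc - t))^-1)%:E.
Proof.
by move=> tTc; rewrite kappaE eta_pinfty// ?mul1r// subr_gt0.
Qed.

Lemma redesigned_time_pinfty s :
  redesigned_time alpha Tc +oo s = Tc * (1 - expN alpha s).
Proof.
by rewrite /redesigned_time at_alpha_neq0 ?gt_eqF// eta_pinfty// invr1 mul1r.
Qed.

(** At the instant of settling, the distance to the pole Tc of the gain is
    Tc exp(- alpha s). *)
Lemma kappa_redesigned_time (s : R) :
  kappa alpha Tc +oo (redesigned_time alpha Tc +oo s%:E)
  = (expR (alpha * s) / (alpha * Tc))%:E.
Proof.
rewrite redesigned_time_pinfty kappa_pinfty /expN /=; last first.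
  by rewrite gtr_pMr// gtrBl expR_gt0.
rewrite [X in alpha * X](_ : _ = Tc * expR (- (alpha * s))); last by ring.
by rewrite mulrA invfM expRN invrK mulrC.
Qed.

Lemma kappa_cvg_pinfty : kappa alpha Tc +oo t @[t --> Tc^'-] --> +oo%E.
Proof.
apply/cvgeyPge => A.
have B0 : 0 < `|A| + 1 by rewrite ltr_wpDl.
near=> t.
have tTc : t < Tc by [].
(* The gain exceeds |A| + 1 as soon as Tc - t < 1 / (alpha (|A| + 1)). *)
have tB : Tc - (alpha * (`|A| + 1))^-1 < t.
  by near: t; apply: nbhs_left_gt; rewrite gtrBl invr_gt0 mulr_gt0.
rewrite kappa_pinfty// lee_fin (le_trans (ler_norm _))//.
rewrite (@le_trans _ _ (`|A| + 1)) ?lerDl//.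
rewrite -[leLHS]invrK lef_pV2 ?posrE ?invr_gt0 ?mulr_gt0 ?subr_gt0//.
by rewrite -ler_pdivlMl// -invfM lerBlDr -lerBlDl ltW.
Unshelve. all: by end_near.
Qed.

(** The gain increases with t and its value at Tc is kappa_max, since
    Tc - eta Tc = Tc exp(- alpha F). *)
Lemma kappa_le_max (F t : R) : 0 <= F -> 0 <= t < Tc ->
  (`|kappa alpha Tc F%:E t| <= (kappa_max alpha Tc F%:E)%:E)%E.
Proof.
move=> F0 /andP[t0 tTc].
have e0 := expR_gt0 (- (alpha * F)).
have etaE : Defs.eta F%:E alpha = 1 - expR (- (alpha * F)) by [].
have eta0 : 0 <= Defs.eta F%:E alpha.
  by rewrite etaE subr_ge0 -[leRHS]expR0 ler_expR oppr_le0 mulr_ge0// ltW.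
have den1 : Tc * expR (- (alpha * F)) <= Tc - Defs.eta F%:E alpha * t.
  rewrite (@le_trans _ _ (Tc - Defs.eta F%:E alpha * Tc))//.
    by rewrite etaE; lra.
  by rewrite lerB // ler_wpM2l // ltW.
have den0 : 0 < Tc - Defs.eta F%:E alpha * t.
  by rewrite (lt_le_trans _ den1)// mulr_gt0.
rewrite kappaE// abse_EFin lee_fin ger0_norm; last first.
  by rewrite divr_ge0// mulr_ge0// ltW.
rewrite /kappa_max at_alpha_neq0 ?gt_eqF//=.
have -> : (expR (alpha * F) - 1) / (alpha * Tc) =
    Defs.eta F%:E alpha / (alpha * (Tc * expR (- (alpha * F)))).
  rewrite etaE expRN; field.
  by rewrite !gt_eqF ?expR_gt0.
by rewrite ler_wpM2l// lef_pV2 ?posrE ?mulr_gt0// ler_wpM2l// ltW.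
Qed.

End Gain.

(** * The change of coordinates *)

Section Coordinates.
Context {R : realType} (n : nat).

(** Right multiplication by the shift moves every entry of a row vector one
    place to the right and the diagonal part moves none, so starting from b_1
    the leading 1 advances by exactly one place at each power. *)
Lemma JDmx_pow_row1_unitriangular (alpha rho : R) (k : nat) (j : 'I_n) :
  (k <= j)%N ->
  ((bvec n 1)^T *m JDmx n alpha rho ^+ k) 0 j = (j == k :> nat)%:R.
Proof.
elim: k j => [|k IH] j kj.
  by rewrite expr0 mulmx1 !mxE eqSS.
rewrite exprSr -mulmxE mulmxA mulmxBr mxE.
have -> : ((bvec n 1)^T *m JDmx n alpha rho ^+ k *m shiftmx n) 0 j =
    (j == k.+1 :> nat)%:R.
  have j1 : (j.-1 < n)%N by rewrite (leq_ltn_trans (leq_pred _)).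
  have jS : j.-1.+1 = j by rewrite prednK// (leq_ltn_trans _ kj).
  rewrite mxE (bigD1 (Ordinal j1))//= big1 => [|i ij].
    rewrite addr0 IH /=; last by rewrite -ltnS jS.
    by rewrite mxE /= jS eqxx mulr1 -[j.-1 == k]eqSS jS.
  rewrite !mxE; case: eqP => // ji; last by rewrite mulr0.
  by case/negP: ij; apply/eqP/val_inj; rewrite /= ji.
rewrite -scalemxAr [X in _ + X]mxE [X in - X]mxE [X in alpha * X]mxE.
rewrite (bigD1 j)//= big1 => [|i ij].
  by rewrite addr0 IH ?(ltnW kj)// (gtn_eqF kj) mul0r mulr0 oppr0 addr0.
by rewrite /Dmx [X in _ * X]mxE (negbTE ij) mulr0n mulr0.
Qed.

Lemma Qmx_unit (alpha rho : R) : Qmx n alpha rho \in unitmx.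
Proof.
have QE (k j : 'I_n) : (k <= j)%N -> Qmx n alpha rho k j = (j == k)%:R.
  by move=> kj; rewrite mxE JDmx_pow_row1_unitriangular.
rewrite unitmxE det_trig.
  by rewrite big1 ?unitr1// => i _; rewrite QE// eqxx.
by apply/is_trig_mxP => i j ij; rewrite QE ?(ltnW ij)// -val_eqE gtn_eqF.
Qed.

Lemma Kmx_unit (alpha rho Tc : R) (Tf : \bar R) (t : R) :
  0 < fine (kappa alpha Tc Tf t) -> Kmx n alpha rho Tc Tf t \in unitmx.
Proof.
move=> k0; rewrite unitmxE det_diag unitfE.
by apply/prodf_neq0 => i _; rewrite mxE gt_eqF// powR_gt0.
Qed.

Lemma beta_min_pinfty_gt0 (alpha rho Tc : R) : 0 < alpha -> 0 < Tc ->
  0 < beta_min n alpha rho Tc +oo.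
Proof.
move=> a0 Tc0; rewrite /beta_min at_alpha_neq0 ?gt_eqF// powR_gt0//.
by rewrite eta_pinfty// invr1 mulr1 mulr_gt0.
Qed.

Lemma settling_time_ge0 (f : (R -> R) -> R -> 'cV[R]_n -> 'cV[R]_n) Pi x0 :
  (0 <= settling_time f Pi x0)%E.
Proof. by apply: le_ereal_inf_tmp => _ [xi [xi0 _] <-]; rewrite lee_fin. Qed.

End Coordinates.

Theorem corollary1 (R : realType) (n : nat) (alpha rho Tc Delta beta : R)
    (Tf : \bar R) (v : 'cV[R]_n -> R) (w : 'cV[R]_n -> R -> R)
    (calT T : 'cV[R]_n -> \bar R) (u : 'cV[R]_n -> R -> R) (kap : R -> \bar R) :
  (0 < n)%N -> 0 <= alpha -> 0 <= rho <= n%:R -> 0 < Tc -> 0 <= Delta ->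
  (0 <= Tf)%E -> (alpha = 0 -> (Tf < +oo)%E) ->
  beta_min n alpha rho Tc Tf <= beta ->
  (* auxiliary system *)
  aux_asymptotically_stable alpha rho Delta v ->
  calT = aux_settling_time alpha rho Delta v ->
  (ereal_sup (range calT) <= Tf)%E ->
  (* closed loop *)
  maintains_origin w Delta ->
  u = hybrid_controller alpha rho Tc Tf beta Delta v w ->
  T = chain_settling_time u Delta ->
  (forall x0, T x0 = (redesigned_time alpha Tc Tf
     (calT (beta^-1 *: (Qmx n alpha rho *m
        invmx (Kmx n alpha rho Tc Tf 0) *m x0))))%:E) ->
  kap = kappa alpha Tc Tf ->
  [/\ (forall z0, z0 != 0 -> calT z0 = +oo%E) ->
      [/\ forall x0, x0 != 0 -> T x0 = Tc%:E,
          prescribed_time_controller u Delta Tc &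
          forall x0, x0 != 0 -> kap t @[t --> (fine (T x0))^'-] --> +oo%E],
      (forall z0, (calT z0 < +oo)%E) ->
      (* no finite uniform bound on the auxiliary settling time *)
      Tf = +oo%E -> ereal_sup (range calT) = Tf ->
      [/\ forall x0, kap (fine (T x0)) \is a fin_num,
          ereal_sup (range (fun x0 => kap (fine (T x0)))) = +oo%E &
          predefined_time_controller u Delta Tc] &
      (Tf < +oo)%E ->
      [/\ forall x0, (T x0 <= Tc%:E)%E,
          forall t, 0 <= t < Tc -> (`|kap t| <= (kappa_max alpha Tc Tf)%:E)%E &
          predefined_time_controller u Delta Tc]].
Proof.
move=> n0 a_ge0 _ Tc0 _ Tf0 aTf beta_ge _ calTE supT _ _ TE Tformula ->.
have calT0 z : (0 <= calT z)%E by rewrite calTE; exact: settling_time_ge0.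
have calTf z : (calT z <= Tf)%E.
  by apply: le_trans supT; exact: ereal_sup_ubound.
have T_le x0 : (T x0 <= Tc%:E)%E by rewrite Tformula lee_fin redesigned_time_le.
have predefined : predefined_time_controller u Delta Tc.
  by apply: ge_ereal_sup => _ [x0 _ <-]; rewrite -TE.
pose P := beta^-1 *: (Qmx n alpha rho *m invmx (Kmx n alpha rho Tc Tf 0)).
have {}Tformula x0 : T x0 = (redesigned_time alpha Tc Tf (calT (P *m x0)))%:E.
  by rewrite Tformula -scalemxAl.
have infinite_horizon : Tf = +oo%E -> 0 < alpha /\ P \in unitmx.
  move=> Tfoo.
  have a0 : 0 < alpha.
    rewrite lt_def a_ge0 andbT; apply/eqP => /aTf.
    by rewrite Tfoo.
  split=> //; rewrite unitmxZ ?unitmx_mul ?Qmx_unit ?unitmx_inv ?Kmx_unit//.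
    by rewrite Tfoo kappa_pinfty// subr0 invr_gt0 mulr_gt0.
  rewrite unitrV unitfE gt_eqF// (lt_le_trans _ beta_ge)// Tfoo.
  exact: beta_min_pinfty_gt0.
split.
- move=> calToo.
  (* As n > 0 there is a nonzero state, whose infinite settling time forces
     Tf to be infinite. *)
  have Tfoo : Tf = +oo%E.
    apply/eqP; rewrite -leye_eq -(calToo (bvec n 1)) ?calTf//.
    apply/eqP => /matrixP/(_ (Ordinal n0) 0); rewrite !mxE eqxx.
    by apply/eqP; rewrite oner_eq0.
  have [a0 Pu] := infinite_horizon Tfoo.
  have TTc x0 : x0 != 0 -> T x0 = Tc%:E.
    move=> x00; rewrite Tformula calToo; last first.
      by apply: contra x00 => /eqP Px0; rewrite -(mulKmx Pu x0) Px0 mulmx0.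
    by rewrite Tfoo redesigned_time_pinfty// expN_pinfty// subr0 mulr1.
  split=> //; first by rewrite /prescribed_time_controller -TE.
  by move=> x0 /TTc -> /=; rewrite Tfoo; exact: kappa_cvg_pinfty.
- move=> calT_fin Tfoo; rewrite Tfoo => sup_calT.
  have [a0 Pu] := infinite_horizon Tfoo.
  have kapE x0 : kappa alpha Tc +oo (fine (T x0)) =
      (expR (alpha * fine (calT (P *m x0))) / (alpha * Tc))%:E.
    by rewrite Tformula Tfoo -kappa_redesigned_time// fineK// ge0_fin_numE.
  split=> //; first by move=> x0; rewrite kapE.
  apply: eq_infty => A.
  (* exp(alpha s) >= alpha s, so s > A Tc is enough for the gain
     exp(alpha s) / (alpha Tc) to exceed A. *)
  have [_ [z _ <-] Az] : exists2 y, range calT y & ((A * Tc)%:E < y)%E.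
    by apply: ereal_sup_gt; rewrite sup_calT ltry.
  apply: (@le_trans _ _ (kappa alpha Tc +oo (fine (T (invmx P *m z))))).
    rewrite kapE mulKVmx// lee_fin ler_pdivlMr ?mulr_gt0//.
    rewrite (le_trans _ (expR_ge1Dx _))// ler_wpDl// mulrCA ler_pM2l// ltW//.
    by rewrite -lte_fin fineK// ge0_fin_numE.
  by apply: ereal_sup_ubound; exists (invmx P *m z).
- move=> Tffin; split=> // t t01.
  move: Tf Tf0 Tffin {calTf supT aTf beta_ge P Tformula infinite_horizon}.
  move=> [F| |]//.
  rewrite lee_fin => F0 _.
  move: a_ge0; rewrite le_eqVlt => /predU1P[<-|a0]; last exact: kappa_le_max.
  rewrite kappa_alpha0// kappa_max_alpha0// abse_EFin ger0_norm//.
  by rewrite divr_ge0// ltW.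
Qed.
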